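(* For $n\in\mathbb{N}$, the number of equivalence classes of the nesting-similarity relation $\sim_{ne}$ on $\mathcal{M}(n)$ equals $2\cdot 4^{n-1}-\frac{3n-1}{2n+2}\binom{2n}{n}$.
   Context: A matching on $[2n]$ is a partition of $[2n]$ into $n$ two-element blocks (edges); $\mathcal{M}(n)$ is the set of such matchings. Edges $A,B$ are nested if $\min A<\min B<\max B<\max A$ or vice versa; $ne(M)$ is the number of nested pairs of edges. For $M\in\mathcal{M}(m)$, its children are the matchings obtained by choosing $x\in\{2,\dots,2m+2\}$, relabeling the vertices of $M$ order-preservingly by $\{2,\dots,2m+2\}\setminus\{x\}$ and adding the edge $\{1,x\}$. $\mathcal{T}(M,0)=\{M\}$ and $\mathcal{T}(M,l+1)$ is the set of children of members of $\mathcal{T}(M,l)$. $M\sim_{ne}N$ means that the multisets $ne(\mathcal{T}(M,l))=\{ne(P):P\in\mathcal{T}(M,l)\}$ and $ne(\mathcal{T}(N,l))$ are equal for every $l\ge 0$. *)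

(* Defs.v *)
From mathcomp Require Import all_boot.
From mathcomp Require Import boolp.
Set Implicit Arguments.
Unset Strict Implicit.
Unset Printing Implicit Defensive.

(* The vertex set [2n] = {1, ..., 2n} is represented by 'I_(n.*2), that is      *)
(* {0, ..., 2n-1}: all vertex labels are shifted down by one. An edge is a set  *)
(* of vertices, a graph is a set of edges.                                      *)
Notation edge k := {set 'I_k}.
Notation graph k := {set {set 'I_k}}.

Definition is_matching (n : nat) (M : graph n.*2) : bool :=
  partition M [set: 'I_(n.*2)] && [forall A in M, #|A| == 2].

Definition matchings (n : nat) : {set graph n.*2} := [set M | is_matching M].

(* The default value k only matters for the empty set. *)
Definition edge_min (k : nat) (A : edge k) : nat := \big[minn/k]_(i in A) i.
Definition edge_max (k : nat) (A : edge k) : nat := \max_(i in A) i.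

Definition covers (k : nat) (A B : edge k) : bool :=
  [&& edge_min A < edge_min B, edge_min B < edge_max B
    & edge_max B < edge_max A].

Definition nested (k : nat) (A B : edge k) : bool := covers A B || covers B A.

Definition ne (k : nat) (M : graph k) : nat :=
  #|[set [set A; B] | A in M, B in M & nested A B]|.

(* With the shifted labels the new edge joins 0 to the vertex                   *)
(* lift ord0 x = x + 1, where x ranges over {0, ..., 2m}; lift ord0 \o lift x   *)
(* is the increasing bijection from {0, ..., 2m-1} onto                         *)
(* {1, ..., 2m+1} \ {x + 1}.                                                    *)
Definition relabel (m : nat) (x : 'I_(m.*2.+1)) (i : 'I_(m.*2)) :
  'I_(m.+1.*2) := lift ord0 (lift x i).

Definition child (m : nat) (M : graph m.*2) (x : 'I_(m.*2.+1)) :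
  graph m.+1.*2 :=
  [set ord0; lift ord0 x] |: [set [set relabel x i | i in A] | A : edge m.*2 in M].

Definition children (m : nat) (M : graph m.*2) : {set graph m.+1.*2} :=
  [set child M x | x : 'I_(m.*2.+1)].

Fixpoint tree (m : nat) (M : graph m.*2) (l : nat) : {set graph (l + m).*2} :=
  match l with
  | 0 => [set M]
  | l'.+1 => \bigcup_(P in tree M l') children P
  end.

Definition ne_similar (m : nat) (M N : graph m.*2) : Prop :=
  forall l, perm_eq [seq ne P | P in tree M l] [seq ne P | P in tree N l].

Lemma ne_similar_equiv (m : nat) :
  equivalence_rel (fun M N : graph m.*2 => `[< ne_similar M N >]).
Proof.
move=> M N P; split; first by apply/asboolP => l.
move=> /asboolP sMN; apply: asbool_equiv_eq; split=> s l.
  by rewrite -(permPl (sMN l)) (permPl (s l)).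
by rewrite (permPl (sMN l)) (permPl (s l)).
Qed.

Definition ne_classes (n : nat) : {set {set graph n.*2}} :=
  equivalence_partition (fun M N => `[< ne_similar M N >]) (matchings n).

(* Main.v *)
Require Import Defs.
From mathcomp Require Import all_boot all_order all_algebra.
From mathcomp Require Import boolp zify ring lra.
Set Implicit Arguments.
Unset Strict Implicit.
Unset Printing Implicit Defensive.
Import Order.TTheory GRing.Theory Num.Theory.

(* Record for each matching which vertices close an edge; this is a Dyck word.
   Adding an edge {1, x} creates one nesting for each edge closed before x, so
   the pair (ne M, word of M) determines the pairs of all children. Hence M and N
   are similar iff they have the same pair: conversely the multiset of ne over
   the children, sorted, reveals the word. On matchings with a given Dyck word w,
   ne takes exactly the values 0, ..., a(w), where a(w) is the sum of h - 1 over
   the down steps of w starting at height h. The number of classes is thus the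
   sum of 1 + a(w) over Dyck words, and the total of a(w) over Dyck words of
   length 2n is the sum of 'C(2n, j) for j <= n - 2. *)

(** * Ballot words *)

(* A word lists the vertices of a matching from left to right, [true] marking
   those that close an edge; [h] is the number of edges already open. *)
Fixpoint ballot (h : nat) (w : seq bool) : bool :=
  match w with
  | [::] => h == 0
  | false :: w' => ballot h.+1 w'
  | true :: w' => (0 < h) && ballot h.-1 w'
  end.

(* An edge closed while [h] edges are open can lie under at most [h - 1] of
   them, so this is the largest number of nestings of a matching with word
   [w]. *)
Fixpoint area (h : nat) (w : seq bool) : nat :=
  match w with
  | [::] => 0
  | false :: w' => area h.+1 w'
  | true :: w' => h.-1 + area h.-1 w'
  end.

(** Starting one higher lifts every height along [a] by one, so the inserted closing step is allowed
    and returns to the old heights for [b]. *)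
Lemma ballot_insert h a b :
  ballot h (a ++ b) -> ballot h.+1 (a ++ true :: b).
Proof. by elim: a h => [|[] a IHa] [|h] //=; apply: IHa. Qed.

(** Each closing step of [a] now happens one level higher and gains 1; those of [b] are unchanged,
    and the inserted step contributes a nonnegative amount. *)
Lemma area_insert h a b : ballot h (a ++ b) ->
  count id a + area h (a ++ b) <= area h.+1 (a ++ true :: b).
Proof.
elim: a h => [|[] a IHa] h /=; first by rewrite leq_addl.
  by case: h => [|h] //= /IHa; lia.
by move=> /IHa; lia.
Qed.

(* Deleting the first [true] leaves the full range of values [e] up to the area
   of the rest; a larger [e] is reached by deleting a later [true]. *)
Lemma ballot_remove h u e : ballot h.+1 u -> e <= area h.+1 u ->
  exists a b, [/\ u = a ++ true :: b, ballot h (a ++ b), count id a <= e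
                & e - count id a <= area h (a ++ b)].
Proof.
elim: u h e => [|[] u IHu] h e //=; last first.
  move=> bu eu; have [a [b [-> ? ? ?]]] := IHu _ _ bu eu.
  by exists (false :: a), b.
move=> bu eu; have [le_e|lt_e] := leqP e (area h u).
  by exists [::], u; split; rewrite ?subn0.
case: h => [|h] in bu eu lt_e *; first by lia.
(* The induction hypothesis is used at its largest admissible value. Since [e] exceeds that value by
   at least 1 and at most [h.+1], both bounds carry over once [true] is put in front of [a]. *)
have [a [b [def_u ? ? ?]]] := IHu _ _ bu (leqnn (area h.+1 u)).
by exists (true :: a), b; split=> //=; rewrite ?def_u //; lia.
Qed.

Fixpoint ballot_words (k h : nat) : seq (seq bool) :=
  match k with
  | 0 => if h == 0 then [:: [::]] else [::]
  | k'.+1 => map (cons false) (ballot_words k' h.+1) ++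
      (if h is h'.+1 then map (cons true) (ballot_words k' h') else [::])
  end.

Lemma mem_map_cons (T : eqType) (x y : T) s ss :
  (x :: s \in map (cons y) ss) = (x == y) && (s \in ss).
Proof.
apply/mapP/andP => [[t t_in [-> ->]] //|[/eqP-> s_in]].
by exists s.
Qed.

Lemma mem_ballot_words k h w :
  (w \in ballot_words k h) = (size w == k) && ballot h w.
Proof.
elim: k h w => [|k IHk] h [|b w] /=.
- by case: h.
- by case: eqP.
- rewrite mem_cat; apply/negP=> /orP[/mapP[] //|].
  by case: h => // h /mapP[].
rewrite mem_cat mem_map_cons IHk eqSS.
by case: b; case: h => [|h] /=; rewrite ?mem_map_cons ?IHk ?andbF ?orbF.
Qed.

Lemma uniq_ballot_words k h : uniq (ballot_words k h).
Proof.
have inj_cons (b : bool) : injective (cons b) by move=> ? ? [].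
elim: k h => [|k IHk] h /=; first by case: (h == 0).
rewrite cat_uniq map_inj_uniq // IHk /=.
case: h => [|h] //=; rewrite map_inj_uniq // IHk andbT.
by apply/hasPn=> _ /mapP[s _ ->]; apply/mapP=> -[].
Qed.

Lemma ballot_words_short k h : k < h -> ballot_words k h = [::].
Proof.
elim: k h => [|k IHk] [|h] //= lt_kh.
by rewrite !IHk //; lia.
Qed.

(** * Matchings and their children *)

Lemma edge_max2 k (a b : 'I_k) : edge_max [set a; b] = maxn a b.
Proof.
apply/eqP; rewrite eqn_leq geq_max; apply/andP; split; last first.
  by rewrite !(leq_bigmax_cond (F := @nat_of_ord k)) // !inE eqxx ?orbT.
by apply/bigmax_leqP=> i; rewrite !inE => /orP[]/eqP->; lia.
Qed.

Lemma edge_min_leq k (A : edge k) i : i \in A -> edge_min A <= i.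
Proof.
rewrite /edge_min => iA; have: i \in index_enum 'I_k by apply: mem_index_enum.
elim: (index_enum _) => //= j s IHs; rewrite inE big_cons => /orP[/eqP<-|/IHs].
  by rewrite iA geq_minl.
by case: ifP => // _; apply: leq_trans (geq_minr _ _).
Qed.

Lemma edge_min2 k (a b : 'I_k) : edge_min [set a; b] = minn a b.
Proof.
apply/eqP; rewrite eqn_leq leq_min !edge_min_leq ?inE ?eqxx ?orbT //=.
rewrite /edge_min; elim/big_ind: _ => [|u v|i].
(* The default value [k] of the minimum is harmless, since it exceeds every vertex. *)
- by have := ltn_ord a; lia.
- by lia.
by rewrite !inE => /orP[]/eqP->; lia.
Qed.

Lemma edge2P k (A : edge k) :
  #|A| == 2 -> exists a b : 'I_k, a < b /\ A = [set a; b].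
Proof.
move=> /cards2P[a [b [neq_ab ->]]].
have [lt_ab|le_ba] := ltnP a b; first by exists a, b.
exists b, a; split; last by rewrite setUC.
by rewrite ltn_neqAle le_ba andbT eq_sym.
Qed.

Lemma covers2 k (a b c d : 'I_k) : a < b -> c < d ->
  covers [set a; b] [set c; d] = (a < c) && (d < b).
Proof.
move=> lt_ab lt_cd; rewrite /covers !edge_min2 !edge_max2.
by rewrite !(minn_idPl (ltnW _)) // !(maxn_idPr (ltnW _)) // lt_cd.
Qed.

Lemma matchingP n (M : graph n.*2) :
  reflect [/\ forall A, A \in M ->
                exists a b : 'I_n.*2, a < b /\ A = [set a; b],
              forall A B i, A \in M -> B \in M -> i \in A -> i \in B -> A = B
            & forall i, exists2 A, A \in M & i \in A]
          (is_matching M).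
Proof.
apply: (iffP andP) => [[/and3P[/eqP covM trivM n0M] /forall_inP card2]|].
  split=> [A AM|A B i AM BM iA iB|i].
  - exact/edge2P/card2.
  - apply/eqP/negPn/negP=> /(trivIsetP trivM _ _ AM BM)/pred0P/(_ i).
    by rewrite /= iA iB.
  - have: i \in cover M by rewrite covM inE.
    by case/bigcupP=> A AM iA; exists A.
case=> edM disjM covM; split; last first.
  apply/forall_inP=> A /edM[a [b [lt_ab ->]]].
  by rewrite cards2 -val_eqE neq_ltn lt_ab.
apply/and3P; split.
- by apply/eqP/setP=> i; rewrite inE; apply/bigcupP; have [A] := covM i; exists A.
- apply/trivIsetP=> A B AM BM neq_AB; apply/pred0P=> i /=.
  by apply/negP=> /andP[iA iB]; case/eqP: neq_AB; apply: disjM iA iB.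
- by apply/negP=> /edM[a [b [_ /setP/(_ a)]]]; rewrite !inE eqxx.
Qed.

Lemma nestedC k (A B : edge k) : nested A B = nested B A.
Proof. by rewrite /nested orbC. Qed.

Lemma nestedxx k (A : edge k) : nested A A = false.
Proof. by rewrite /nested /covers ltnn. Qed.

Definition nested_pairs k (M : graph k) : {set {set edge k}} :=
  [set [set A; B] | A in M, B in M & nested A B].

Section Child.

Variables (m : nat) (x : 'I_m.*2.+1).
Implicit Types (M : graph m.*2) (A B : edge m.*2).

Definition new_edge : edge m.+1.*2 := [set ord0; lift ord0 x].
Definition relabel_edge A : edge m.+1.*2 := [set relabel x i | i in A].

Lemma childE M : child M x = new_edge |: [set relabel_edge A | A in M].
Proof. by []. Qed.

Lemma relabel_inj : injective (@relabel m x).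
Proof. by move=> i j /lift_inj/lift_inj. Qed.

Lemma relabel_edge_inj : injective relabel_edge.
Proof. exact: imset_inj relabel_inj. Qed.

Lemma mem_relabel_edge A i : (relabel x i \in relabel_edge A) = (i \in A).
Proof. exact: mem_imset relabel_inj. Qed.

Lemma relabelNnew i : relabel x i \notin new_edge.
Proof.
rewrite !inE negb_or; apply/andP; split; first by rewrite eq_sym neq_lift.
by apply/eqP=> /lift_inj/eqP; rewrite eq_sym (negPf (neq_lift _ _)).
Qed.

Lemma relabel_onto j : j \notin new_edge -> exists i, j = relabel x i.
Proof.
rewrite !inE negb_or => /andP[j0 jx].
case: (unliftP ord0 j) => [j' def_j|def_j]; last by rewrite def_j eqxx in j0.
case: (unliftP x j') => [i def_j'|def_j'].
  by exists i; rewrite def_j def_j'.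
by rewrite def_j def_j' eqxx in jx.
Qed.

Lemma ord0_relabel_edge A : ord0 \notin relabel_edge A.
Proof. by apply/imsetP=> -[i _] /eqP; rewrite (negPf (neq_lift _ _)). Qed.

Lemma new_edge_neq A : (relabel_edge A == new_edge) = false.
Proof.
apply/eqP=> /setP/(_ ord0).
by rewrite (negPf (ord0_relabel_edge A)) !inE eqxx.
Qed.

Lemma mem_child M A : (relabel_edge A \in child M x) = (A \in M).
Proof. by rewrite childE !inE new_edge_neq (mem_imset _ _ relabel_edge_inj). Qed.

Lemma childP M (B : edge m.+1.*2) :
  reflect (B = new_edge \/ exists2 A, A \in M & B = relabel_edge A)
  (B \in child M x).
Proof.
rewrite childE; apply: (iffP setU1P) => -[-> | ]; try by left.
  by case/imsetP=> A AM ->; right; exists A.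
by case=> A AM ->; right; apply: imset_f.
Qed.

Lemma relabel_lt i j : (relabel x i < relabel x j) = (i < j).
Proof. by rewrite /relabel /= /bump; lia. Qed.

Lemma relabel_edge2 a b : relabel_edge [set a; b] = [set relabel x a; relabel x b].
Proof. by rewrite /relabel_edge imsetU1 imset_set1. Qed.

Lemma child_matching M : is_matching M -> is_matching (child M x).
Proof.
case/matchingP=> edM disjM covM; apply/matchingP; split.
- move=> B /childP[->|[A /edM[a [b [lt_ab ->]]] ->]].
    by exists ord0, (lift ord0 x).
  by exists (relabel x a), (relabel x b); rewrite relabel_lt relabel_edge2.
- move=> A' B' i /childP[->|[A AM ->]] /childP[->|[B BM ->]] //.
  + by move=> iE /imsetP[j _ def_i]; rewrite def_i (negPf (relabelNnew j)) in iE.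
  + by move=> /imsetP[j _ def_i] iE; rewrite def_i (negPf (relabelNnew j)) in iE.
  move=> /imsetP[j jA ->]; rewrite mem_relabel_edge => jB.
  by rewrite (disjM _ _ _ AM BM jA jB).
move=> i; have [iE|/relabel_onto[j ->]] := boolP (i \in new_edge).
  by exists new_edge; first by apply/childP; left.
have [A AM jA] := covM j; exists (relabel_edge A); first by rewrite mem_child.
by rewrite mem_relabel_edge.
Qed.

Lemma nested_relabel A B :
  #|A| == 2 -> #|B| == 2 -> nested (relabel_edge A) (relabel_edge B) = nested A B.
Proof.
move=> /edge2P[a [b [lt_ab ->]]] /edge2P[c [d [lt_cd ->]]].
by rewrite !relabel_edge2 /nested !covers2 ?relabel_lt.
Qed.

(** The new edge starts at the least vertex, so it can only be the outer one, and only the right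
    ends have to be compared. *)
Lemma nested_new_edge A : #|A| == 2 ->
  nested new_edge (relabel_edge A) = (edge_max A < x).
Proof.
move=> /edge2P[a [b [lt_ab ->]]].
rewrite relabel_edge2 /nested !covers2 ?relabel_lt // edge_max2.
by rewrite (maxn_idPr (ltnW lt_ab)) /= /bump; lia.
Qed.

(** The nested pairs of the child are the relabelled old pairs and the pairs containing the new
    edge. The two families are disjoint, and each is parametrized injectively. *)
Lemma ne_child M : is_matching M ->
  ne (child M x) = ne M + #|[set A in M | edge_max A < x]|.
Proof.
case/andP=> _ /forall_inP card2M.
pose old := [set relabel_edge @: p | p : {set edge m.*2} in nested_pairs M].
pose new := [set [set new_edge; relabel_edge A] | A in [set A in M | edge_max A < x]].
have -> : ne (child M x) = #|old :|: new|.
  congr #|pred_of_set _|; apply/setP=> p; apply/imset2P/setUP.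
    case=> A' B' /childP[->|[A AM ->]]; rewrite inE => /andP[/childP[->|[B BM ->]]].
    - by rewrite nestedxx.
    - rewrite nested_new_edge ?card2M // => lt_Bx ->; right.
      by apply: imset_f; rewrite inE BM.
    - rewrite nestedC nested_new_edge ?card2M // => lt_Ax ->; right.
      by rewrite setUC; apply: imset_f; rewrite inE AM.
    rewrite nested_relabel ?card2M // => nAB ->; left.
    apply/imsetP; exists [set A; B]; last by rewrite imsetU1 imset_set1.
    by apply/imset2P; exists A B; rewrite ?inE ?BM.
  case=> [/imsetP[_ /imset2P[A B AM /[!inE]/andP[BM nAB] ->] ->]|/imsetP[A]].
    exists (relabel_edge A) (relabel_edge B); first by rewrite mem_child.
      by rewrite inE mem_child BM nested_relabel ?card2M.
    by rewrite imsetU1 imset_set1.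
  rewrite inE => /andP[AM lt_Ax] ->; exists new_edge (relabel_edge A) => //.
    by apply/childP; left.
  by rewrite inE mem_child AM nested_new_edge ?card2M.
rewrite cardsU; have -> : old :&: new = set0.
  apply/setP=> p; rewrite [RHS]inE; apply/setIP => -[/imsetP[q _ ->] /imsetP[A _]].
  move/setP/(_ new_edge); rewrite !inE eqxx => /imsetP[B _ /eqP].
  by rewrite eq_sym new_edge_neq.
rewrite cards0 subn0 !card_imset //; last exact: imset_inj relabel_edge_inj.
move=> A B /setP/(_ (relabel_edge B)).
by rewrite !inE new_edge_neq eqxx /= (inj_eq relabel_edge_inj) => /eqP->.
Qed.

End Child.

(** * The word of a matching *)

Definition closer k (M : graph k) (i : nat) : bool :=
  [exists A in M, edge_max A == i].

Definition word m (M : graph m.*2) : seq bool := mkseq (closer M) m.*2.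

Definition insert_pair (w : seq bool) (x : nat) : seq bool :=
  false :: take x w ++ true :: drop x w.

Lemma size_word m (M : graph m.*2) : size (word M) = m.*2.
Proof. exact: size_mkseq. Qed.

(** This allows edges to be counted by their closing vertices. *)
Lemma edge_max_inj m (M : graph m.*2) :
  is_matching M -> {in M &, injective (@edge_max m.*2)}.
Proof.
case/matchingP=> edM disjM _ A B AM BM eq_max.
have mem C : C \in M -> exists2 j : 'I_m.*2, j \in C & edge_max C = j.
  case/edM=> a [b [lt_ab ->]]; exists b; first by rewrite !inE eqxx orbT.
  by rewrite edge_max2 (maxn_idPr (ltnW lt_ab)).
have [[i iA max_A] [j jB max_B]] := (mem A AM, mem B BM).
apply: (disjM _ _ i) => //; suff -> : i = j by [].
by apply: val_inj; rewrite /= -max_A eq_max.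
Qed.

Lemma card_closed m (M : graph m.*2) x : is_matching M -> x <= m.*2 ->
  #|[set A in M | edge_max A < x]| = count id (take x (word M)).
Proof.
move=> matM le_x.
rewrite /word /mkseq -map_take take_iota (minn_idPl le_x) count_map.
rewrite -size_filter -(size_image (@edge_max m.*2)); apply: perm_size.
apply: uniq_perm.
- apply/dinjectiveP=> A B; rewrite !inE => /andP[AM _] /andP[BM _].
  exact: edge_max_inj matM A B AM BM.
- exact: filter_uniq (iota_uniq _ _).
move=> i; rewrite mem_filter mem_iota /= add0n.
apply/imageP/andP => [[A /[!inE]/andP[AM lt_Ax] ->]|[/existsP[A /andP[AM /eqP def_i]] lt_ix]].
  by split=> //; apply/existsP; exists A; rewrite AM /=.
by exists A; rewrite // inE AM def_i.
Qed.

Lemma edge_max_relabel m (x : 'I_m.*2.+1) (A : edge m.*2) :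
  #|A| == 2 -> edge_max (relabel_edge x A) = (bump x (edge_max A)).+1.
Proof.
move=> /edge2P[a [b [lt_ab ->]]]; rewrite relabel_edge2 !edge_max2.
have lt_r : relabel x a < relabel x b by rewrite relabel_lt.
by rewrite (maxn_idPr (ltnW lt_ab)) (maxn_idPr (ltnW lt_r)).
Qed.

Lemma closer_child m (M : graph m.*2) (x : 'I_m.*2.+1) i : is_matching M ->
  closer (child M x) i =
    (i == x.+1) || [exists A in M, (bump x (edge_max A)).+1 == i].
Proof.
case/andP=> _ /forall_inP card2M.
apply/existsP/orP=> [[B /andP[/childP[->|[A AM ->]]]]|].
- by rewrite edge_max2 => /eqP<-; left.
- rewrite edge_max_relabel ?card2M // => def_i; right.
  by apply/existsP; exists A; rewrite AM.
case=> [/eqP->|/existsP[A /andP[AM def_i]]].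
  exists (new_edge x); rewrite edge_max2 eqxx andbT.
  by apply/childP; left.
by exists (relabel_edge x A); rewrite mem_child AM edge_max_relabel ?card2M.
Qed.

Lemma word_child m (M : graph m.*2) (x : 'I_m.*2.+1) : is_matching M ->
  word (child M x) = insert_pair (word M) x.
Proof.
move=> matM; have le_x : x <= m.*2 by rewrite -ltnS.
apply: (@eq_from_nth _ false).
  rewrite size_word /= size_cat /= -addSnnS addSn -size_cat cat_take_drop.
  by rewrite size_word doubleS.
rewrite size_word => i lt_i; rewrite nth_mkseq // closer_child //.
case: i lt_i => [|i] lt_i /=.
  by apply/existsP=> -[A /andP[_ /eqP]].
rewrite nth_cat size_takel ?size_word // eqSS.
(* After the leading [false], every position other than [x] is [bump x j] for a unique [j] and
   inherits its letter from [M]; position [x] holds the new closing vertex. *)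
have bumpK j : [exists A in M, (bump x (edge_max A)).+1 == (bump x j).+1] = closer M j.
  apply: eq_existsb => A; rewrite eqSS; congr (_ && _).
  by rewrite (inj_eq (can_inj (bumpK x))).
case: (ltngtP i x) => [lt_ix|lt_xi|->]; rewrite ?subnn //=.
  have {1}-> : i = bump x i by rewrite /bump leqNgt lt_ix.
  rewrite bumpK nth_take // nth_mkseq //; lia.
have -> : i - x = (i.-1 - x).+1 by lia.
rewrite /= nth_drop subnKC; last by lia.
have {1}-> : i = bump x i.-1 by rewrite /bump; lia.
by rewrite bumpK nth_mkseq //; lia.
Qed.

Lemma ne_child_word m (M : graph m.*2) (x : 'I_m.*2.+1) : is_matching M ->
  ne (child M x) = ne M + count id (take x (word M)).
Proof. by move=> matM; rewrite ne_child // card_closed // -ltnS. Qed.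

(** The partner of [ord0] reveals [x], and the other edges reveal the parent. Hence distinct choices
    never collide, and a tree level, although a set, loses no multiplicity. *)
Lemma child_inj m (M N : graph m.*2) (x y : 'I_m.*2.+1) :
  child M x = child N y -> M = N /\ x = y.
Proof.
move=> eq_c; have eq_xy : x = y.
  have: new_edge x \in child N y by rewrite -eq_c; apply/childP; left.
  case/childP=> [/setP/(_ (lift ord0 x))|[A _ /setP/(_ ord0)]].
    rewrite !inE eqxx orbT eq_sym (negPf (neq_lift _ _)) /= => /esym/eqP.
    exact: lift_inj.
  by rewrite (negPf (ord0_relabel_edge _ _)) !inE eqxx.
by split=> //; apply/setP=> A; rewrite -(mem_child x) eq_c eq_xy mem_child.
Qed.

Lemma matching_child m (P : graph m.+1.*2) : is_matching P ->
  exists M x, is_matching M /\ P = @child m M x.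
Proof.
case/matchingP=> edP disjP covP.
have [E EP E0] := covP ord0.
have [x def_E] : exists x : 'I_m.*2.+1, E = new_edge x.
  have [a [b [lt_ab def_E]]] := edP E EP.
  have a0 : a = ord0.
    by move: E0; rewrite def_E !inE => /orP[/eqP//|/eqP b0]; rewrite -b0 in lt_ab.
  case: (unliftP ord0 b) => [x def_b|b0]; last by rewrite b0 in lt_ab.
  by exists x; rewrite def_E a0 def_b.
(* Any edge other than [E] avoids both ends of [E], so all its vertices are relabelled ones. *)
have oldP B : B \in P -> B != E -> exists A, B = relabel_edge x A.
  move=> BP neq_BE; exists [set i | relabel x i \in B]; apply/setP=> j.
  have [jE|/relabel_onto[i ->]] := boolP (j \in new_edge x).
    have /negPf-> : j \notin B.
      by apply: contra neq_BE => jB; apply/eqP/(disjP _ _ j); rewrite // def_E.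
    apply/esym/negP=> /imsetP[i _ def_j].
    by rewrite def_j (negPf (relabelNnew _ _)) in jE.
  by rewrite mem_relabel_edge inE.
pose M : graph m.*2 := [set A | relabel_edge x A \in P].
exists M, x; split.
  apply/matchingP; split=> [A|A B i|i].
  - rewrite inE => /edP[a [b [lt_ab eq_A]]]; apply: edge2P.
    rewrite -(card_imset _ (@relabel_inj _ x)) -/(relabel_edge x A) eq_A.
    by rewrite cards2 -val_eqE neq_ltn lt_ab.
  - rewrite !inE => AP BP iA iB; apply: (@relabel_edge_inj _ x).
    by apply: (disjP _ _ (relabel x i)); rewrite ?mem_relabel_edge.
  have [B BP iB] := covP (relabel x i).
  have neq_BE : B != E.
    apply/eqP=> eq_BE; move: iB.
    by rewrite eq_BE def_E (negPf (relabelNnew _ _)).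
  have [A def_B] := oldP B BP neq_BE; rewrite def_B in BP iB.
  by exists A; rewrite ?inE // -(mem_relabel_edge x).
apply/setP=> B; apply/idP/childP=> [BP|[->|[A /[!inE] AM ->]]] //; last first.
  by rewrite -def_E.
have [->|neq_BE] := eqVneq B E; first by left.
have [A def_B] := oldP B BP neq_BE; right; exists A => //.
by rewrite inE -def_B.
Qed.

(** * Similarity classes *)

Definition profile m (M : graph m.*2) : nat * seq bool := (ne M, word M).

Definition child_profile (p : nat * seq bool) (x : nat) : nat * seq bool :=
  (p.1 + count id (take x p.2), insert_pair p.2 x).

Definition child_profiles (p : nat * seq bool) : seq (nat * seq bool) :=
  [seq child_profile p x | x <- iota 0 (size p.2).+1].

Lemma profile_child m (M : graph m.*2) (x : 'I_m.*2.+1) : is_matching M ->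
  profile (child M x) = child_profile (profile M) x.
Proof. by move=> matM; rewrite /profile ne_child_word // word_child. Qed.

Lemma profiles_child m (M : graph m.*2) : is_matching M ->
  [seq profile (child M x) | x <- enum 'I_m.*2.+1] = child_profiles (profile M).
Proof.
move=> matM; rewrite /child_profiles size_word -val_enum_ord -map_comp.
by apply: eq_map => x; rewrite /= profile_child.
Qed.

Lemma tree_matching m (M : graph m.*2) l (P : graph (l + m).*2) :
  is_matching M -> P \in tree M l -> is_matching P.
Proof.
move=> matM; elim: l P => [|l IHl] P /=; first by rewrite inE => /eqP->.
by case/bigcupP=> Q /IHl matQ /imsetP[x _ ->]; apply: child_matching.
Qed.

Lemma enum_tree m (M : graph m.*2) l :
  perm_eq (enum (tree M l.+1))
    [seq child P x | P <- enum (tree M l), x <- enum 'I_(l + m).*2.+1].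
Proof.
apply: uniq_perm; first exact: enum_uniq.
  apply: allpairs_uniq; rewrite ?enum_uniq //.
  by move=> [P x] [Q y] _ _ /= /child_inj[-> ->].
move=> P; rewrite mem_enum; apply/bigcupP/allpairsP.
  by case=> Q QT /imsetP[x _ ->]; exists (Q, x); rewrite !mem_enum.
case=> -[Q x] /= [/[!mem_enum] QT _ ->]; exists Q => //.
exact: imset_f.
Qed.

(** The multiset of profiles at one level determines that of the next, so equality of profiles
    propagates down the tree. *)
Lemma profiles_tree m (M : graph m.*2) l : is_matching M ->
  perm_eq [seq profile P | P <- enum (tree M l.+1)]
    (flatten [seq child_profiles p | p <- [seq profile P | P <- enum (tree M l)]]).
Proof.
move=> matM; rewrite (perm_trans (perm_map _ (enum_tree M l))) //.
rewrite map_allpairs -map_comp.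
suff -> : [seq (child_profiles \o @profile (l + m)) P | P <- enum (tree M l)]
   = [seq [seq profile (child P x) | x <- enum 'I_(l + m).*2.+1] | P <- enum (tree M l)]
  by [].
apply/eq_in_map=> P; rewrite mem_enum => /(tree_matching matM) matP.
by rewrite /= profiles_child.
Qed.

(** Each letter is the difference of two consecutive prefix counts. *)
Lemma prefix_counts_inj (v w : seq bool) : size v = size w ->
  (forall x, x <= size v -> count id (take x v) = count id (take x w)) -> v = w.
Proof.
move=> eq_sz eq_c; apply: (@eq_from_nth _ false) => // i lt_i.
have := eq_c _ lt_i; rewrite !(take_nth false) -?eq_sz //.
rewrite -!cats1 !count_cat eq_c ?(ltnW lt_i) // => /addnI.
by rewrite /= !addn0; do 2 case: nth.
Qed.

Lemma sorted_prefix_counts e (w : seq bool) n :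
  sorted leq [seq e + count id (take x w) | x <- iota 0 n].
Proof.
apply: (homo_sorted (e := leq)) (iota_sorted 0 n) => x y le_xy.
by rewrite leq_add2l -(subnKC le_xy) takeD count_cat leq_addr.
Qed.

(* At level 1 the values of [ne] are [ne M] plus the number of edges closed
   before the inserted vertex; sorted, this sequence gives back the word. *)
Lemma ne_similarP m (M N : graph m.*2) : is_matching M -> is_matching N ->
  ne_similar M N <-> profile M = profile N.
Proof.
move=> matM matN; split=> [simMN|eq_p l]; last first.
  (* The induction needs whole profiles: the values of [ne] alone do not determine those of the next
     level. *)
  suff: perm_eq [seq profile P | P <- enum (tree M l)]
                [seq profile P | P <- enum (tree N l)].
    by move/(perm_map fst); rewrite -!map_comp.
  elim: l => [|l IHl]; first by rewrite /= !enum_set1 /= eq_p.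
  rewrite (perm_trans (profiles_tree l matM)) // perm_sym.
  rewrite (perm_trans (profiles_tree l matN)) // perm_sym.
  exact: perm_flatten (perm_map _ IHl).
have eq_ne : ne M = ne N.
  have := simMN 0; rewrite /image_mem /= !enum_set1 /= => /perm_mem/(_ (ne M)).
  by rewrite !inE eqxx => /esym/eqP.
have ne_level1 (P : graph m.*2) : is_matching P ->
    perm_eq [seq ne Q | Q in tree P 1]
      [seq ne P + count id (take x (word P)) | x <- iota 0 m.*2.+1].
  move=> matP; have := perm_map fst (profiles_tree 0 matP).
  by rewrite /= enum_set1 /= cats0 -!map_comp size_word.
have eq_c : [seq ne M + count id (take x (word M)) | x <- iota 0 m.*2.+1] =
            [seq ne N + count id (take x (word N)) | x <- iota 0 m.*2.+1].
  apply: (sorted_eq leq_trans anti_leq); try exact: sorted_prefix_counts.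
  rewrite -(permPl (ne_level1 M matM)) (permPl (simMN 1)).
  exact: ne_level1.
rewrite /profile eq_ne; congr pair; apply: prefix_counts_inj.
  by rewrite !size_word.
rewrite size_word => x le_x.
have := congr1 (nth 0 ^~ x) eq_c; rewrite !(nth_map 0) ?size_iota ?ltnS //.
by rewrite nth_iota ?ltnS // eq_ne => /addnI.
Qed.

(** * The profiles that occur, and the number of classes *)

Definition ballot_profiles (n : nat) : seq (nat * seq bool) :=
  [seq (e, w) | w <- ballot_words n.*2 0, e <- iota 0 (area 0 w).+1].

Lemma mem_ballot_profiles n e w : ((e, w) \in ballot_profiles n) =
  [&& size w == n.*2, ballot 0 w & e <= area 0 w].
Proof.
apply/allpairsPdep/and3P => [[w' [e' [w_in e_in [-> ->]]]]|[sw bw le_e]].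
  by move: w_in e_in; rewrite mem_ballot_words mem_iota add0n ltnS => /andP[].
by exists w, e; rewrite mem_ballot_words sw bw mem_iota.
Qed.

Lemma ballot_insert_pair w x : ballot 0 w -> ballot 0 (insert_pair w x).
Proof. by move=> bw; apply: ballot_insert; rewrite cat_take_drop. Qed.

Lemma size_insert_pair w x : size (insert_pair w x) = (size w).+2.
Proof.
by rewrite /= size_cat /= -addSnnS addSn -size_cat cat_take_drop.
Qed.

Lemma matching0 (M : graph 0.*2) : is_matching M = (M == set0).
Proof.
apply/matchingP/eqP => [[edM _ _]|->].
  by apply/setP=> A; rewrite inE; apply/negP=> /edM[[]].
by split=> [A|A B i|[]] //; rewrite inE.
Qed.

Lemma profile_set0 : profile (set0 : graph 0.*2) = (0, [::]).
Proof.
congr pair; apply/eqP; rewrite cards_eq0; apply/eqP/setP=> p; rewrite inE.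
by apply/imset2P=> -[A B]; rewrite in_set0.
Qed.

(** Induction on the edge at the first vertex: [area_insert] bounds [ne] from above, and
    [ballot_remove] chooses the closing vertex of that edge so that the remaining nestings fit the
    shorter word. *)
Lemma profile_matchings n :
  [seq profile M | M in matchings n] =i ballot_profiles n.
Proof.
elim: n => [|n IHn] [e w]; rewrite mem_ballot_profiles; last first.
  apply/imageP/and3P => [[P /[!inE] /matching_child[M [x [matM ->]]]]|].
    have : profile M \in ballot_profiles n by rewrite -IHn image_f ?inE.
    rewrite profile_child // mem_ballot_profiles => /and3P[/eqP sw bw le_e].
    case=> -> ->; split; rewrite ?size_insert_pair ?sw ?ballot_insert_pair //.
    apply: leq_trans (area_insert _); rewrite cat_take_drop //.
    by rewrite addnC leq_add2l.
  case: w => [|[] u] [/eqP] //= [su] bu le_e.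
  have [a [b [def_u bab le_ae le_eab]]] := ballot_remove bu le_e.
  have sab : size (a ++ b) = n.*2.
    by move: su; rewrite def_u !size_cat /= addnS => -[].
  have /imageP[M /[!inE] matM eq_M] :
      (e - count id a, a ++ b) \in [seq profile M | M in matchings n].
    by rewrite IHn mem_ballot_profiles sab eqxx bab.
  have lt_a : size a < n.*2.+1 by rewrite ltnS -sab size_cat leq_addr.
  exists (child M (Ordinal lt_a)); first by rewrite inE child_matching.
  rewrite profile_child // -eq_M /child_profile /insert_pair /=.
  by rewrite take_size_cat // drop_size_cat // subnK // def_u.
apply/imageP/and3P => [[M /[!inE] /[!matching0] /eqP-> /[!profile_set0] -[-> ->]]|].
  by [].
case=> /nilP-> _ /=; rewrite leqn0 => /eqP->.
by exists set0; rewrite ?inE ?matching0 ?profile_set0.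
Qed.

(** The classes are exactly the nonempty fibres of [f] on [D], one for each value taken. *)
Lemma card_equivalence_partition (T : finType) (U : eqType) (R : rel T)
    (D : {set T}) (f : T -> U) :
  {in D &, forall x y, R x y = (f x == f y)} ->
  #|equivalence_partition R D| = size (undup [seq f x | x in D]).
Proof.
move=> Rf; pose fiber u := [set y in D | f y == u].
have -> : equivalence_partition R D = [set:: map fiber (undup [seq f x | x in D])].
  apply/setP=> B; rewrite inE; apply/imsetP/mapP => [[x xD ->]|[u]].
    exists (f x); first by rewrite mem_undup image_f.
    by apply/setP=> y; rewrite !inE; case yD: (y \in D); rewrite //= Rf // eq_sym.
  rewrite mem_undup => /imageP[x xD ->] ->; exists x => //.
  by apply/setP=> y; rewrite !inE; case yD: (y \in D); rewrite //= Rf // eq_sym.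
rewrite cardsE.
rewrite (card_uniqP _) ?size_map // map_inj_in_uniq ?undup_uniq //.
move=> u v; rewrite !mem_undup => /imageP[x xD ->] _ /setP/(_ x).
by rewrite !inE xD eqxx => /esym/eqP.
Qed.

Lemma uniq_ballot_profiles n : uniq (ballot_profiles n).
Proof.
apply: allpairs_uniq_dep => [|w _|]; rewrite ?uniq_ballot_words ?iota_uniq //.
by move=> [w e] [w' e'] _ _ /= [-> ->].
Qed.

Lemma card_ne_classes n :
  #|ne_classes n| = \sum_(w <- ballot_words n.*2 0) (area 0 w).+1.
Proof.
rewrite (card_equivalence_partition (f := @profile n)) => [|M N].
  have -> : size (undup [seq profile M | M in matchings n]) = size (ballot_profiles n).
    apply/perm_size/uniq_perm; rewrite ?undup_uniq ?uniq_ballot_profiles //.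
    by move=> p; rewrite mem_undup profile_matchings.
  rewrite size_allpairs_dep sumnE big_map; apply: eq_bigr => w _.
  by rewrite size_iota.
rewrite !inE => matM matN; apply/asboolP/eqP => [|eq_p].
  by move/(ne_similarP matM matN).
exact/(ne_similarP matM matN).
Qed.

(** * Counting *)

Local Open Scope ring_scope.

(** Partial row sums of Pascal's triangle also obey Pascal's rule, so the path recurrences become
    linear identities; rational values keep subtraction exact. *)
Definition binsum (k m : nat) : rat := \sum_(i < m) 'C(k, i)%:R.

Lemma binsum0 k : binsum k 0 = 0.
Proof. exact: big_ord0. Qed.

Lemma binsumS k m : binsum k m.+1 = binsum k m + 'C(k, m)%:R.
Proof. exact: big_ord_recr. Qed.

Lemma binsum_pascal k m : binsum k.+1 m.+1 = binsum k m.+1 + binsum k m.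
Proof.
elim: m => [|m IHm]; first by rewrite !binsumS !binsum0 !bin0 addr0.
by rewrite binsumS IHm binS natrD [binsum k m.+2]binsumS
  {2}[binsum k m.+1]binsumS; ring.
Qed.

Lemma binsum_full k : binsum k k.+1 = 2 ^+ k.
Proof.
elim: k => [|k IHk]; first by rewrite binsumS binsum0 bin0 expr0.
by rewrite binsum_pascal binsumS bin_small // IHk exprS; ring.
Qed.

(** Reflecting [i] to [k - i] turns the second sum into the terms of the row that the first one
    lacks. *)
Lemma binsum_sym k m : (m <= k.+1)%N ->
  binsum k m + binsum k (k.+1 - m) = 2 ^+ k.
Proof.
elim: m => [|m IHm] le_mk; first by rewrite binsum0 add0r subn0 binsum_full.
rewrite -IHm; last by lia.
rewrite subSS subSn // !binsumS bin_sub //; ring.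
Qed.

(** The two sides of an even row around its middle term have equal sums; this is the source of the
    power of 4 in the final formula. *)
Lemma binsum_central n : 2 * binsum n.*2 n + 'C(n.*2, n)%:R = 4 ^+ n.
Proof.
have := @binsum_sym n.*2 n; have -> : (n.*2.+1 - n = n.+1)%N by lia.
rewrite binsumS => H; have -> : (4 : rat) = 2 ^+ 2 by [].
by rewrite -exprM mul2n -H; [ring | lia].
Qed.

Lemma sum_ballot_words k h (F : seq bool -> rat) :
  \sum_(w <- ballot_words k.+1 h) F w =
  \sum_(w <- ballot_words k h.+1) F (false :: w) +
  (if h is h'.+1 then \sum_(w <- ballot_words k h') F (true :: w) else 0).
Proof.
by rewrite big_cat big_map; case: h => [|h]; rewrite ?big_nil ?big_map.
Qed.

(* The closed form counts unrestricted paths and subtracts reflected ones: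
   [binsum k m.+1 - binsum k m] is the binomial 'C(k, m) and
   [binsum k m - binsum k m.-1] is 'C(k, m.-1), or 0 when m = 0. *)
Lemma size_ballot_words h m :
  \sum_(w <- ballot_words (h + m.*2) h) 1 =
  binsum (h + m.*2) m.+1 - 2 * binsum (h + m.*2) m + binsum (h + m.*2) m.-1.
Proof.
have [k def_k] : exists k, k = (h + m.*2)%N by eexists.
rewrite -!def_k; elim: k h m def_k => [|k IHk] h m def_k.
  have [-> ->] : h = 0%N /\ m = 0%N by lia.
  by rewrite /= big_seq1 binsumS binsum0.
rewrite sum_ballot_words; case: m => [|m] in def_k *.
  (* With [m = 0] the letters just suffice to close the open edges, so no word begins by opening
     another. *)
  rewrite ballot_words_short ?big_nil; last by lia.
  case: h => [|h] in def_k *; first by lia.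
  rewrite (IHk h 0%N); last by lia.
  by rewrite !binsumS !binsum0 !bin0 /=; ring.
rewrite (IHk h.+1 m); last by lia.
case: h => [|h] in def_k *.
  (* At height 0 no word begins with a closing step. Here [k] is odd, and the equality of its two
     middle binomials makes up for the absent term. *)
  have sym : 'C(k, m.+1) = 'C(k, m) by rewrite -bin_sub; [congr 'C(_, _)|]; lia.
  rewrite !binsum_pascal /=; case: m => [|m] in def_k sym *.
    by rewrite !binsumS !binsum0 sym /=; ring.
  rewrite !binsum_pascal /= (binsumS _ m.+2) (binsumS _ m.+1) sym.
  by rewrite (binsumS _ m); ring.
rewrite (IHk h m.+1) /=; last by lia.
rewrite !binsum_pascal /=; case: m => [|m] in def_k *.
  by rewrite !binsum0; ring.
by rewrite !binsum_pascal /=; ring.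
Qed.

(* With W(h) = 'C(k, m) and T(h) = W(h) + W(h + 2) + ..., the right-hand side is
   h (h - 1) / 2 W(h) + h W(h + 2) + (h + 1) T(h + 4), the solution of the
   first-step recurrence vanishing at h = -1. *)
Lemma area_ballot_words h m (k := (h + m.*2)%N) :
  \sum_(w <- ballot_words k h) (area h w)%:R =
  h%:R * (h%:R - 1) / 2 * (binsum k m.+1 - binsum k m)
  + h%:R * (binsum k m - binsum k m.-1) + (h%:R + 1) * binsum k m.-1.
Proof.
have: k = (h + m.*2)%N by []; move: k => k def_k.
elim: k h m def_k => [|k IHk] h m def_k.
  have [-> ->] : h = 0%N /\ m = 0%N by lia.
  by rewrite /= big_seq1 !binsum0 /= mulr0n !mul0r mulr0 !addr0.
rewrite sum_ballot_words /=; case: m => [|m] in def_k *.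
  rewrite ballot_words_short ?big_nil; last by lia.
  case: h => [|h] in def_k *; first by lia.
  (* The first closing step adds [h] to the area of every word; writing it as [h%:R * 1] lets the
     number of words factor out. *)
  under eq_bigr do rewrite natrD -[h%:R]mulr1.
  rewrite big_split /= -mulr_sumr (IHk h 0%N); last by lia.
  have -> : k = (h + 0.*2)%N by lia.
  rewrite size_ballot_words ?binsumS ?binsum0 ?bin0 /= -[h.+1]addn1 natrD.
  by field.
rewrite (IHk h.+1 m); last by lia.
case: h => [|h] in def_k *.
  rewrite !binsum_pascal /=; case: m => [|m] in def_k *.
    by rewrite !binsum0; field.
  by rewrite !binsum_pascal /=; field.
under [X in _ + X = _]eq_bigr do rewrite natrD -[h%:R]mulr1.
rewrite big_split /= -mulr_sumr (IHk h m.+1) /=; last by lia.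
have -> : k = (h + m.+1.*2)%N by lia.
rewrite size_ballot_words /= !binsum_pascal -[h.+2]addn2 -[h.+1]addn1 !natrD.
case: m => [|m] in def_k *.
  by rewrite !binsum0; field.
by rewrite !binsum_pascal /=; field.
Qed.

Theorem theorem3p5 (n : nat) :
  #|ne_classes n|%:R =
    2 * 4 ^ (n%:Z - 1)
      - (3 * n%:R - 1) / (2 * n%:R + 2) * 'C(2 * n, n)%:R :> rat.
Proof.
have -> : (4 : rat) ^ (n%:Z - 1) = 4 ^+ n / 4.
  by rewrite expfzDr.
rewrite card_ne_classes natr_sum mul2n -binsum_central.
under eq_bigr do rewrite -addn1 natrD.
rewrite big_split /= (area_ballot_words 0 n) (size_ballot_words 0 n) add0n.
(* The case [n = 0] is separate because [n.-1] truncates there. *)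
have [->|n_gt0] := posnP n; first by rewrite !binsumS !binsum0.
case: n => // n in n_gt0 *; rewrite /= !binsumS.
(* The partial sums up to [n] cancel, leaving two adjacent binomials; this identity expresses the
   first through the central one. *)
have : n.+2%:R * 'C(n.+1.*2, n)%:R = n.+1%:R * 'C(n.+1.*2, n.+1)%:R :> rat.
  have := mul_bin_left n.+1.*2 n; have -> : (n.+1.*2 - n = n.+2)%N by lia.
  by move=> H; rewrite -!natrM H.
move/(congr1 (fun t => n.+2%:R^-1 * t)); rewrite mulKf ?pnatr_eq0 // => ->.
rewrite -[n.+2]addn2 -[n.+1]addn1 !natrD; field.
by apply/andP; split; apply: lt0r_neq0; have := ler0n rat n; lra.
Qed.
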